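(* For any weak distributive law $\varrho:\mathcal{E}\mathcal{M}\to\mathcal{M}\mathcal{E}$ in $\mathsf{SetMat}$, there is an orthogonal factorization system $\overline{\mathcal{E}}\hookrightarrow\mathcal{M}_\varrho\mathcal{E}\hookleftarrow\overline{\mathcal{M}}$ on the associated product category $\mathcal{M}_\varrho\mathcal{E}$, together with identity-on-objects functors $\mathcal{E}\to\overline{\mathcal{E}}$ and $\mathcal{M}\to\overline{\mathcal{M}}$.
   Context: Composites are written $gf$ for ''first $f$, then $g$''. **Weak distributive laws in $\mathsf{SetMat}$.** $\mathsf{SetMat}$ is the bicategory of sets, set-valued matrices, and matrices of functions; monads in it are small categories. A weak distributive law $\varrho:\mathcal{E}\mathcal{M}\to\mathcal{M}\mathcal{E}$ in $\mathsf{SetMat}$ amounts to two small categories $\mathcal{E}$ and $\mathcal{M}$ with the same set of objects $\mathcal{O}$ and, for all $a,b,c\in\mathcal{O}$, a function $$\mathcal{E}(b,c)\times\mathcal{M}(a,b)\to\coprod_{x\in\mathcal{O}}\mathcal{M}(x,c)\times\mathcal{E}(a,x),\qquad (e,m)\mapsto(e\triangleright m,\,e\triangleleft m),$$ where $e.m\in\mathcal{O}$ denotes the index $x$ of the summand, so that $e\triangleleft m:a\to e.m$ in $\mathcal{E}$ and $e\triangleright m:e.m\to c$ in $\mathcal{M}$, such that for all $e:c\to b'$, $f:b'\to a'$ in $\mathcal{E}$ and $n:a\to b$, $m:b\to c$ in $\mathcal{M}$: - $1_c.m=1_b.1_b$ and $e.1_c=1_{b'}.1_{b'}$; - $(fe).m=f.(e\triangleright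 m)$ and $e.(mn)=(e\triangleleft m).n$; - $1_c\triangleleft m=1_b\triangleleft 1_b$ and $e\triangleleft 1_c=(1_{b'}\triangleleft 1_{b'})e$; - $(fe)\triangleleft m=[f\triangleleft(e\triangleright m)](e\triangleleft m)$ and $e\triangleleft(mn)=(e\triangleleft m)\triangleleft n$; - $1_c\triangleright m=m(1_b\triangleright 1_b)$ and $e\triangleright 1_c=1_{b'}\triangleright 1_{b'}$; - $(fe)\triangleright m=f\triangleright(e\triangleright m)$ and $e\triangleright(mn)=(e\triangleright m)[(e\triangleleft m)\triangleright n]$. **The product category.** $\mathcal{M}_\varrho\mathcal{E}$ is the small category with object set $\mathcal{O}$ whose morphisms $a\to c$ are the pairs $(1_c\triangleright m,\;e\triangleleft 1_a)=(m(1_b\triangleright1_b),\,(1_b\triangleleft1_b)e)$ for $b\in\mathcal{O}$, $e:a\to b$ in $\mathcal{E}$, $m:b\to c$ in $\mathcal{M}$ (so $e\triangleleft1_a:a\to1_b.1_b$ in $\mathcal{E}$ and $1_c\triangleright m:1_b.1_b\to c$ in $\mathcal{M}$). The identity at $a$ is $(1_a\triangleright1_a,1_a\triangleleft1_a)$ and composition is $(1_c\triangleright n,f\triangleleft1_b)(1_b\triangleright m,e\triangleleft1_a)=(n(f\triangleright m),(f\triangleleft m)e)$ for $e:a\to x$, $f:b\to y$ in $\mathcal{E}$ and $m:x\to b$, $n:y\to c$ in $\mathcal{M}$. **Orthogonal factorization systems.** A subcategory $\mathcal{D}\hookrightarrow\mathcal{C}$ with the same objects here means a category $\mathcal{D}$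 with an identity-on-objects functor to $\mathcal{C}$ that is injective on morphisms. An orthogonal factorization system on a small category $\mathcal{C}$ is given by subcategories $\overline{\mathcal{E}}\hookrightarrow\mathcal{C}\hookleftarrow\overline{\mathcal{M}}$, both containing all isomorphisms of $\mathcal{C}$, such that any morphism $f$ of $\mathcal{C}$ admits a (not necessarily unique) decomposition $f=me$ with $e$ in $\overline{\mathcal{E}}$ and $m$ in $\overline{\mathcal{M}}$, and such that for all $e:x\to a$ in $\overline{\mathcal{E}}$, $m:y\to b$ in $\overline{\mathcal{M}}$ and all morphisms $u:x\to y$, $v:a\to b$ in $\mathcal{C}$ with $mu=ve$ there is a unique morphism $t:a\to y$ in $\mathcal{C}$ with $te=u$ and $mt=v$. *)

(* Defs.v *)
From Stdlib Require Import ProofIrrelevance.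

Set Implicit Arguments.
Unset Strict Implicit.
Unset Printing Implicit Defensive.

(** Small categories with a prescribed set of objects.  Composites are written
    [g ∘ f] for "first [f], then [g]". *)

Record category (O : Type) := Category {
  hom : O -> O -> Type;
  idm : forall a, hom a a;
  comp : forall a b c, hom b c -> hom a b -> hom a c;
  comp_idl : forall a b (f : hom a b), comp (idm b) f = f;
  comp_idr : forall a b (f : hom a b), comp f (idm a) = f;
  compA : forall a b c d (h : hom c d) (g : hom b c) (f : hom a b),
    comp h (comp g f) = comp (comp h g) f
}.

Arguments hom {O} C a b : rename.
Arguments idm {O} C a : rename.
Arguments comp {O C a b c} g f : rename.

Declare Scope cat_scope.
Delimit Scope cat_scope with cat.
Notation "g ∘ f" := (comp g f) (at level 40, left associativity) : cat_scope.
Open Scope cat_scope.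

Record io_functor (O : Type) (C D : category O) := IOFunctor {
  fmap : forall a b, hom C a b -> hom D a b;
  fmap_id : forall a, fmap (idm C a) = idm D a;
  fmap_comp : forall a b c (g : hom C b c) (f : hom C a b),
    fmap (g ∘ f) = fmap g ∘ fmap f
}.

Arguments fmap {O C D} F {a b} f : rename.

Definition is_iso (O : Type) (C : category O) (a b : O) (f : hom C a b) : Prop :=
  exists g : hom C b a, g ∘ f = idm C a /\ f ∘ g = idm C b.

Record subcategory (O : Type) (C : category O) := Subcategory {
  subcat :> category O;
  incl : io_functor subcat C;
  incl_inj : forall a b (f g : hom subcat a b),
    fmap incl f = fmap incl g -> f = g
}.

Arguments incl {O C} D : rename.

Definition contains_isos (O : Type) (C : category O) (D : subcategory C) : Prop :=
  forall a b (f : hom C a b),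
    is_iso f -> exists f' : hom D a b, fmap (incl D) f' = f.

Record orthogonal_factorization_system (O : Type) (C : category O) :=
  OrthogonalFactorizationSystem {
  left_class : subcategory C;
  right_class : subcategory C;
  left_isos : contains_isos left_class;
  right_isos : contains_isos right_class;
  ofs_factor : forall a c (f : hom C a c),
    exists (b : O) (e : hom left_class a b) (m : hom right_class b c),
      f = fmap (incl right_class) m ∘ fmap (incl left_class) e;
  ofs_orthogonal : forall x a y b
    (e : hom left_class x a) (m : hom right_class y b)
    (u : hom C x y) (v : hom C a b),
    fmap (incl right_class) m ∘ u = v ∘ fmap (incl left_class) e ->
    exists! t : hom C a y,
      t ∘ fmap (incl left_class) e = u /\ fmap (incl right_class) m ∘ t = v
}.

Section WeakDistributiveLaw.

Context (O : Type) (E M : category O).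

(** The hom-set [a -> c] of the composite matrix [M E], i.e. the coproduct over
    [x] of [M(x,c) × E(a,x)]. *)
Definition coprod (a c : O) : Type := {x : O & (hom M x c * hom E a x)%type}.

Definition span (a x c : O) (m : hom M x c) (e : hom E a x) : coprod a c :=
  existT _ x (m, e).

Definition mid (a c : O) (s : coprod a c) : O := projT1 s.
Definition mpart (a c : O) (s : coprod a c) : hom M (mid s) c := fst (projT2 s).
Definition epart (a c : O) (s : coprod a c) : hom E a (mid s) := snd (projT2 s).

Definition cast_cod (C : category O) (a x y : O) (p : x = y) (f : hom C a x) :
  hom C a y := eq_rect x (fun z => hom C a z) f y p.

Definition cast_dom (C : category O) (x y c : O) (p : x = y) (f : hom C x c) :
  hom C y c := eq_rect x (fun z => hom C z c) f y p.

(** [mid (rho e m)] is [e.m], [mpart (rho e m)] is [e ▷ m] and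
    [epart (rho e m)] is [e ◁ m].  The equations between morphisms compare
    homs whose types agree only up to the equations between objects, along
    which the left-hand sides are transported. *)
Record weak_distributive_law := WeakDistributiveLaw {
  rho : forall a b c, hom E b c -> hom M a b -> coprod a c;

  dot_1l : forall b c (m : hom M b c),
    mid (rho (idm E c) m) = mid (rho (idm E b) (idm M b));
  dot_1r : forall c b' (e : hom E c b'),
    mid (rho e (idm M c)) = mid (rho (idm E b') (idm M b'));
  dot_compl : forall b c b' a' (f : hom E b' a') (e : hom E c b') (m : hom M b c),
    mid (rho (f ∘ e) m) = mid (rho f (mpart (rho e m)));
  dot_compr : forall a b c b' (e : hom E c b') (m : hom M b c) (n : hom M a b),
    mid (rho e (m ∘ n)) = mid (rho (epart (rho e m)) n);

  epart_1l : forall b c (m : hom M b c),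
    cast_cod (dot_1l m) (epart (rho (idm E c) m))
    = epart (rho (idm E b) (idm M b));
  epart_1r : forall c b' (e : hom E c b'),
    cast_cod (dot_1r e) (epart (rho e (idm M c)))
    = epart (rho (idm E b') (idm M b')) ∘ e;
  epart_compl : forall b c b' a' (f : hom E b' a') (e : hom E c b') (m : hom M b c),
    cast_cod (dot_compl f e m) (epart (rho (f ∘ e) m))
    = epart (rho f (mpart (rho e m))) ∘ epart (rho e m);
  epart_compr : forall a b c b' (e : hom E c b') (m : hom M b c) (n : hom M a b),
    cast_cod (dot_compr e m n) (epart (rho e (m ∘ n)))
    = epart (rho (epart (rho e m)) n);

  mpart_1l : forall b c (m : hom M b c),
    cast_dom (dot_1l m) (mpart (rho (idm E c) m))
    = m ∘ mpart (rho (idm E b) (idm M b));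
  mpart_1r : forall c b' (e : hom E c b'),
    cast_dom (dot_1r e) (mpart (rho e (idm M c)))
    = mpart (rho (idm E b') (idm M b'));
  mpart_compl : forall b c b' a' (f : hom E b' a') (e : hom E c b') (m : hom M b c),
    cast_dom (dot_compl f e m) (mpart (rho (f ∘ e) m))
    = mpart (rho f (mpart (rho e m)));
  mpart_compr : forall a b c b' (e : hom E c b') (m : hom M b c) (n : hom M a b),
    cast_dom (dot_compr e m n) (mpart (rho e (m ∘ n)))
    = mpart (rho e m) ∘ mpart (rho (epart (rho e m)) n)
}.

(** Two-sided action of [M] and [E] on the composite matrix; it lets the four
    unit and multiplication laws be stated as equations in the coproduct. *)
Definition act (a b c d : O) (m : hom M c d) (e : hom E a b) (s : coprod b c) :
  coprod a d := span (m ∘ mpart s) (epart s ∘ e).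

Lemma act_id a c (s : coprod a c) : act (idm M c) (idm E a) s = s.
Proof.
destruct s as [x [m e]]; unfold act, span; simpl.
now rewrite comp_idl, comp_idr.
Qed.

Lemma act_act a a' b c d d' (m : hom M d d') (n : hom M c d)
  (e : hom E a a') (f : hom E a' b) (s : coprod b c) :
  act m e (act n f s) = act (m ∘ n) (f ∘ e) s.
Proof.
destruct s as [x [p q]]; unfold act, span; cbn.
now rewrite !compA.
Qed.

Lemma cast_span a c (s : coprod a c) y (m : hom M y c) (e : hom E a y)
  (p : mid s = y) :
  cast_dom p (mpart s) = m -> cast_cod p (epart s) = e -> s = span m e.
Proof.
destruct s as [x [n f]]; simpl in p; destruct p; simpl.
now intros <- <-.
Qed.

Context (r : weak_distributive_law).

Lemma rho_1l b c (m : hom M b c) :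
  rho r (idm E c) m = act m (idm E b) (rho r (idm E b) (idm M b)).
Proof.
apply (cast_span (mpart_1l r m)).
rewrite comp_idr; apply epart_1l.
Qed.

Lemma rho_1r c b' (e : hom E c b') :
  rho r e (idm M c) = act (idm M b') e (rho r (idm E b') (idm M b')).
Proof.
refine (cast_span _ (epart_1r r e)).
rewrite comp_idl; apply mpart_1r.
Qed.

Lemma rho_compl b c b' a' (f : hom E b' a') (e : hom E c b') (m : hom M b c) :
  rho r (f ∘ e) m = act (idm M a') (epart (rho r e m)) (rho r f (mpart (rho r e m))).
Proof.
refine (cast_span _ (epart_compl r f e m)).
rewrite comp_idl; apply mpart_compl.
Qed.

Lemma rho_compr a b c b' (e : hom E c b') (m : hom M b c) (n : hom M a b) :
  rho r e (m ∘ n) = act (mpart (rho r e m)) (idm E a) (rho r (epart (rho r e m)) n).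
Proof.
apply (cast_span (mpart_compr r e m n)).
rewrite comp_idr; apply epart_compr.
Qed.

(** The pair [(1_c ▷ m, e ◁ 1_a) = (m(1_b ▷ 1_b), (1_b ◁ 1_b)e)], with its
    middle object [1_b.1_b]; by [rho_1l] and [rho_1r] both forms agree. *)
Definition rep (a b c : O) (m : hom M b c) (e : hom E a b) : coprod a c :=
  span (m ∘ mpart (rho r (idm E b) (idm M b))) (epart (rho r (idm E b) (idm M b)) ∘ e).

Definition is_prod_mor (a c : O) (s : coprod a c) : Prop :=
  exists (b : O) (e : hom E a b) (m : hom M b c), s = rep m e.

Definition prod_hom (a c : O) : Type := {s : coprod a c | is_prod_mor s}.

(** [(n(f ▷ m), (f ◁ m)e)] for [t = (n, f)] and [s = (m, e)].  No representatives
    are chosen: see [raw_comp_rep] below. *)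
Definition raw_comp (a b c : O) (t : coprod b c) (s : coprod a b) : coprod a c :=
  act (mpart t) (epart s) (rho r (epart t) (mpart s)).

Lemma raw_compA a b c d (u : coprod c d) (t : coprod b c) (s : coprod a b) :
  raw_comp u (raw_comp t s) = raw_comp (raw_comp u t) s.
Proof.
destruct u as [z [k g]], t as [y [n f]], s as [x [m e]].
unfold raw_comp; cbn.
rewrite rho_compr, rho_compl, !act_act.
rewrite !comp_idl, !comp_idr; unfold act; cbn.
rewrite !compA; reflexivity.
Qed.

Lemma act_rho_idl x b y (f : hom E b y) (m : hom M x b) :
  act (mpart (rho r (idm E y) (idm M y))) (idm E x)
    (rho r (epart (rho r (idm E y) (idm M y)) ∘ f) m) = rho r f m.
Proof.
transitivity (rho r (idm E y ∘ f) (m)); [|now rewrite comp_idl].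
rewrite !rho_compl, act_act.
transitivity (act (idm M y) (epart (rho r f m))
  (rho r (idm E y) (idm M y ∘ mpart (rho r f m)))); [|now rewrite comp_idl].
now rewrite rho_compr, act_act, !comp_idl, !comp_idr.
Qed.

Lemma act_rho_idr x b y (f : hom E b y) (m : hom M x b) :
  act (idm M y) (epart (rho r (idm E x) (idm M x)))
    (rho r f (m ∘ mpart (rho r (idm E x) (idm M x)))) = rho r f m.
Proof.
transitivity (rho r f (m ∘ idm M x)); [|now rewrite comp_idr].
rewrite !rho_compr, act_act.
transitivity (act (mpart (rho r f m)) (idm E x)
  (rho r (epart (rho r f m) ∘ idm E x) (idm M x))); [|now rewrite comp_idr].
now rewrite rho_compl, act_act, !comp_idl, !comp_idr.
Qed.

(** [raw_comp] is the composition of the product category: it takes the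
    prescribed value on all representatives. *)
Lemma raw_comp_rep a x b y c (n : hom M y c) (f : hom E b y)
  (m : hom M x b) (e : hom E a x) :
  raw_comp (rep n f) (rep m e)
  = span (n ∘ mpart (rho r f m)) (epart (rho r f m) ∘ e).
Proof.
change (raw_comp (rep n f) (rep m e) = act n e (rho r f m)).
rewrite <- (act_rho_idl f m), <- (act_rho_idr _ m), !act_act.
now rewrite comp_idl, comp_idr.
Qed.

Lemma rho_rep x b y (f : hom E b y) (m : hom M x b) :
  rho r f m = rep (mpart (rho r f m)) (epart (rho r f m)).
Proof.
change (rho r f m = act (mpart (rho r f m)) (epart (rho r f m))
  (rho r (idm E _) (idm M _))).
transitivity (rho r (idm E y ∘ f) m); [now rewrite comp_idl|].
now rewrite rho_compl, rho_1l, act_act, comp_idl, comp_idl.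
Qed.

Lemma act_rep a a' b c c' (n : hom M c c') (f : hom E a' a)
  (m : hom M b c) (e : hom E a b) :
  act n f (rep m e) = rep (n ∘ m) (e ∘ f).
Proof. apply act_act. Qed.

Lemma is_prod_mor_rep a b c (m : hom M b c) (e : hom E a b) :
  is_prod_mor (rep m e).
Proof. now exists b, e, m. Qed.

Lemma rho_id a : rho r (idm E a) (idm M a) = rep (idm M a) (idm E a).
Proof. symmetry; apply act_id. Qed.

Lemma is_prod_mor_id a : is_prod_mor (rho r (idm E a) (idm M a)).
Proof. rewrite rho_id; apply is_prod_mor_rep. Qed.

Lemma is_prod_mor_comp a b c (t : coprod b c) (s : coprod a b) :
  is_prod_mor (raw_comp t s).
Proof.
unfold raw_comp; rewrite rho_rep, act_rep; apply is_prod_mor_rep.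
Qed.

Lemma raw_comp_idl a c (s : coprod a c) :
  is_prod_mor s -> raw_comp (rho r (idm E c) (idm M c)) s = s.
Proof.
intros [b [e [m ->]]].
rewrite rho_id, raw_comp_rep.
change (act (idm M c) e (rho r (idm E c) m) = rep m e).
now rewrite rho_1l, act_act, comp_idl, comp_idl.
Qed.

Lemma raw_comp_idr a c (s : coprod a c) :
  is_prod_mor s -> raw_comp s (rho r (idm E a) (idm M a)) = s.
Proof.
intros [b [e [m ->]]].
rewrite rho_id, raw_comp_rep.
change (act m (idm E a) (rho r e (idm M a)) = rep m e).
now rewrite rho_1r, act_act, comp_idr, comp_idr.
Qed.

Lemma prod_hom_inj a c (s t : prod_hom a c) : proj1_sig s = proj1_sig t -> s = t.
Proof.
destruct s as [s hs], t as [t ht]; simpl; intros <-.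
f_equal; apply proof_irrelevance.
Qed.

Definition prod_id (a : O) : prod_hom a a :=
  exist _ (rho r (idm E a) (idm M a)) (is_prod_mor_id a).

Definition prod_comp (a b c : O) (t : prod_hom b c) (s : prod_hom a b) :
  prod_hom a c :=
  exist _ (raw_comp (proj1_sig t) (proj1_sig s))
    (is_prod_mor_comp (proj1_sig t) (proj1_sig s)).

Lemma prod_comp_idl a b (f : prod_hom a b) : prod_comp (prod_id b) f = f.
Proof. apply prod_hom_inj, raw_comp_idl, (proj2_sig f). Qed.

Lemma prod_comp_idr a b (f : prod_hom a b) : prod_comp f (prod_id a) = f.
Proof. apply prod_hom_inj, raw_comp_idr, (proj2_sig f). Qed.

Lemma prod_compA a b c d (h : prod_hom c d) (g : prod_hom b c) (f : prod_hom a b) :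
  prod_comp h (prod_comp g f) = prod_comp (prod_comp h g) f.
Proof. apply prod_hom_inj, raw_compA. Qed.

Definition product_category : category O :=
  Category prod_comp_idl prod_comp_idr prod_compA.

End WeakDistributiveLaw.

(* Main.v *)
Require Import Defs.
From Stdlib Require Import ProofIrrelevance.

Set Implicit Arguments.
Unset Strict Implicit.
Unset Printing Implicit Defensive.

(** Write [i_x = 1_x ▷ 1_x] and [p_x = 1_x ◁ 1_x].  The assignments
    [e ↦ (i, pe)] and [m ↦ (mi, p)] are functors from [E] and [M] to the product
    category, and every morphism [(mi, pe)] is the composite of the images of
    [e] and [m].  Their images need not contain the isomorphisms, so they have
    to be enlarged.  The enlargement comes for free from orthogonality: take as
    left class everything left orthogonal to the image of [M], and as right
    class everything right orthogonal to that left class.  Orthogonality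
    classes contain all isomorphisms and are closed under composition, and the
    two classes are orthogonal to each other by construction.  They yield a
    factorization system receiving functors from [E] and [M] as soon as the
    image of [E] lies in the left class, that is, as soon as the image of [E]
    is orthogonal to the image of [M] ([factorization_system_generated]).

    That orthogonality is visible on components ([E_orth_M]).  A morphism of the
    product category is literally a pair (its [M]-part, its [E]-part), not a
    class of such pairs; postcomposing with the image of [m] changes only the
    [M]-part, to [m ∘ -], and precomposing with the image of [e] changes only the
    [E]-part, to [- ∘ e].  In a commutative square from [e] to [m] with top [u]
    and bottom [v], the middle objects of [u] and [v] thus coincide, and a
    diagonal must take its [M]-part from [u] and its [E]-part from [v].  This
    pair is again a morphism of the product category because such morphisms are
    the pairs fixed by [(m, e) ↦ (mi, pe)], and the condition can be tested on
    each component separately. *)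

(** * Orthogonality in a category *)

Section Orthogonality.

Context (O : Type) (C : category O).

Definition orth (x a y b : O) (e : hom C x a) (m : hom C y b) : Prop :=
  forall (u : hom C x y) (v : hom C a b), m ∘ u = v ∘ e ->
    exists! t : hom C a y, t ∘ e = u /\ m ∘ t = v.

Lemma is_iso_id a : is_iso (idm C a).
Proof. exists (idm C a); now rewrite comp_idl. Qed.

Lemma orth_iso_l x a y b (e : hom C x a) (m : hom C y b) :
  is_iso e -> orth e m.
Proof.
intros [g [ge eg]] u v sq; exists (u ∘ g); split; [split|].
- now rewrite <- compA, ge, comp_idr.
- now rewrite compA, sq, <- compA, eg, comp_idr.
- intros t [<- _]; now rewrite <- compA, eg, comp_idr.
Qed.

Lemma orth_iso_r x a y b (e : hom C x a) (m : hom C y b) :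
  is_iso m -> orth e m.
Proof.
intros [g [gm mg]] u v sq; exists (g ∘ v); split; [split|].
- now rewrite <- compA, <- sq, compA, gm, comp_idl.
- now rewrite compA, mg, comp_idl.
- intros t [_ <-]; now rewrite compA, gm, comp_idl.
Qed.

Lemma orth_comp_l x a c y b (f : hom C a c) (e : hom C x a) (m : hom C y b) :
  orth e m -> orth f m -> orth (f ∘ e) m.
Proof.
intros He Hf u v sq; rewrite compA in sq.
destruct (He _ _ sq) as [s [[se ms] s_uniq]].
destruct (Hf _ _ ms) as [t [[tf mt] t_uniq]].
exists t; split; [split; [now rewrite compA, tf|assumption]|].
intros t' [tfe' mt']; apply t_uniq; split; [|assumption].
symmetry; apply s_uniq; split; [now rewrite <- compA|].
now rewrite compA, mt'.
Qed.

Lemma orth_comp_r x a y b d (e : hom C x a) (n : hom C b d) (m : hom C y b) :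
  orth e n -> orth e m -> orth e (n ∘ m).
Proof.
intros Hn Hm u v sq; rewrite <- compA in sq.
destruct (Hn _ _ sq) as [s [[se ns] s_uniq]].
destruct (Hm _ _ (eq_sym se)) as [t [[te mt] t_uniq]].
exists t; split; [split; [assumption|now rewrite <- compA, mt]|].
intros t' [te' nmt']; apply t_uniq; split; [assumption|].
symmetry; apply s_uniq; split; [now rewrite <- compA, te'|].
now rewrite compA.
Qed.

End Orthogonality.

(** * Wide subcategories cut out by a property of morphisms *)

Section WideSubcategory.

Context (O : Type) (C : category O) (P : forall a b, hom C a b -> Prop).
Context (P_id : forall a, P (idm C a)).
Context (P_comp : forall a b c (g : hom C b c) (f : hom C a b),
  P g -> P f -> P (g ∘ f)).

Lemma sig_inj (A : Type) (Q : A -> Prop) (s t : {x : A | Q x}) :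
  proj1_sig s = proj1_sig t -> s = t.
Proof. apply eq_sig_hprop; intros; apply proof_irrelevance. Qed.

Definition wide_comp a b c (g : {g : hom C b c | P g}) (f : {f : hom C a b | P f}) :
  {h : hom C a c | P h} :=
  exist _ (proj1_sig g ∘ proj1_sig f) (P_comp (proj2_sig g) (proj2_sig f)).

Definition wide_category : category O.
Proof.
refine (@Category O (fun a b => {f : hom C a b | P f})
          (fun a => exist _ (idm C a) (P_id a)) wide_comp _ _ _);
  intros; apply sig_inj; cbn.
- apply comp_idl.
- apply comp_idr.
- apply compA.
Defined.

Definition wide_incl : io_functor wide_category C :=
  @IOFunctor O wide_category C (fun a b f => proj1_sig f)
    (fun a => eq_refl) (fun a b c g f => eq_refl).

Definition wide_subcategory : subcategory C :=
  @Subcategory O C wide_category wide_incl (fun a b f g => @sig_inj _ _ f g).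

Definition corestrict (D : category O) (F : io_functor D C)
  (PF : forall a b (f : hom D a b), P (fmap F f)) : io_functor D wide_subcategory.
Proof.
refine (@IOFunctor O D wide_category
          (fun a b f => exist _ (fmap F f) (PF a b f)) _ _);
  intros; apply sig_inj; cbn.
- apply fmap_id.
- apply fmap_comp.
Defined.

End WideSubcategory.

(** * Factorization systems generated by two orthogonal functors *)

Section Generated.

Context (O : Type) (C E M : category O).
Context (L : io_functor E C) (R : io_functor M C).

Definition in_left a b (e : hom C a b) : Prop :=
  forall y z (m : hom M y z), orth e (fmap R m).

Definition in_right y b (m : hom C y b) : Prop :=
  forall x a (e : hom C x a), in_left e -> orth e m.

Lemma in_left_iso a b (e : hom C a b) : is_iso e -> in_left e.
Proof. intros he y z m; now apply orth_iso_l. Qed.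

Lemma in_right_iso y b (m : hom C y b) : is_iso m -> in_right m.
Proof. intros hm x a e _; now apply orth_iso_r. Qed.

Lemma in_left_comp a b c (f : hom C b c) (e : hom C a b) :
  in_left f -> in_left e -> in_left (f ∘ e).
Proof. intros hf he y z m; now apply orth_comp_l. Qed.

Lemma in_right_comp a b c (n : hom C b c) (m : hom C a b) :
  in_right n -> in_right m -> in_right (n ∘ m).
Proof. intros hn hm x y e he; apply orth_comp_r; auto. Qed.

Definition left_subcategory : subcategory C :=
  wide_subcategory (fun a => in_left_iso (is_iso_id C a)) in_left_comp.

Definition right_subcategory : subcategory C :=
  wide_subcategory (fun a => in_right_iso (is_iso_id C a)) in_right_comp.

(** The image of [M] lies in the right class and the two classes are orthogonal
    by the Galois connection alone.  Orthogonality of the two images is what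
    puts the image of [E] into the left class, so that the given
    factorizations are factorizations in the two classes. *)
Lemma factorization_system_generated :
  (forall a c (f : hom C a c), exists b (e : hom E a b) (m : hom M b c),
      f = fmap R m ∘ fmap L e) ->
  (forall x a y b (e : hom E x a) (m : hom M y b), orth (fmap L e) (fmap R m)) ->
  exists F : orthogonal_factorization_system C,
    inhabited (io_functor E (left_class F)) /\
    inhabited (io_functor M (right_class F)).
Proof.
intros factor L_orth_R.
assert (R_right : forall y b (m : hom M y b), in_right (fmap R m)).
{ intros y b m x a e he; apply he. }
assert (L_left : forall x a (e : hom E x a), in_left (fmap L e)).
{ intros x a e y b m; apply L_orth_R. }
unshelve eexists.
- refine (@OrthogonalFactorizationSystem O C left_subcategory right_subcategory
            _ _ _ _).
  + intros a b f hf; now exists (exist _ f (in_left_iso hf)).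
  + intros a b f hf; now exists (exist _ f (in_right_iso hf)).
  + intros a c f; destruct (factor a c f) as [b [e [m ->]]].
    now exists b, (exist _ (fmap L e) (L_left _ _ e)),
      (exist _ (fmap R m) (R_right _ _ m)).
  + intros x a y b e m u v; exact (proj2_sig m _ _ _ (proj2_sig e) u v).
- split; constructor; cbn.
  + exact (corestrict _ _ L_left).
  + exact (corestrict _ _ R_right).
Qed.

End Generated.

(** * The product category of a weak distributive law *)

Section ProductCategory.

Context (O : Type) (E M : category O) (r : weak_distributive_law E M).

Lemma span_inj a x c (m n : hom M x c) (e f : hom E a x) :
  span m e = span n f -> m = n /\ e = f.
Proof. intros H; now apply inj_pair2 in H; injection H. Qed.

(** [rep] is idempotent, so the morphisms of the product category are exactly
    its fixed points. *)
Lemma is_prod_mor_span a x c (m : hom M x c) (e : hom E a x) :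
  is_prod_mor r (span m e) <-> rep r m e = span m e.
Proof.
split.
- intros [b [f [n H]]].
  change (rep r (mpart (span m e)) (epart (span m e)) = span m e).
  rewrite H.
  transitivity (act n f (rep r (mpart (rho r (idm E b) (idm M b)))
                               (epart (rho r (idm E b) (idm M b))))).
  + now rewrite act_rep.
  + now rewrite <- rho_rep.
- intros <-; apply is_prod_mor_rep.
Qed.

(** The span [s] stands for [(i_x, p_x)].  Acting on it by [m] and [e] affects
    the two components independently once the middle object of [s] is known to
    be [x], so the fixed point conditions for the two components may come from
    different pairs. *)
Lemma act_fixed_mix a a' x c c' (s : coprod E M x x)
  (m : hom M x c) (n : hom M x c') (e : hom E a x) (f : hom E a' x) :
  act m e s = span m e -> act n f s = span n f -> act m f s = span m f.
Proof.
destruct s as [z [i p]]; unfold act; cbn; intros H1 H2.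
assert (zx : z = x) by exact (f_equal (@mid _ _ _ _ _) H1).
destruct zx.
apply span_inj in H1 as [-> _], H2 as [_ ->]; reflexivity.
Qed.

Lemma is_prod_mor_mix a a' x c c' (m : hom M x c) (n : hom M x c')
  (e : hom E a x) (f : hom E a' x) :
  is_prod_mor r (span m e) -> is_prod_mor r (span n f) ->
  is_prod_mor r (span m f).
Proof.
intros hm%is_prod_mor_span hf%is_prod_mor_span; apply is_prod_mor_span.
exact (act_fixed_mix hm hf).
Qed.

(** This lemma and its mirror image [raw_comp_E] are what makes squares between
    the images of [E] and [M] computable: on one side only the [M]-part changes,
    on the other only the [E]-part. *)
Lemma raw_comp_M a b c (m : hom M b c) (s : coprod E M a b) :
  is_prod_mor r s -> raw_comp r (rep r m (idm E b)) s = act m (idm E a) s.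
Proof.
intros [x [e [n ->]]]; rewrite raw_comp_rep, act_rep.
change (act m e (rho r (idm E b) n) = rep r (m ∘ n) (e ∘ idm E a)).
now rewrite rho_1l, act_act, comp_idl, comp_idr.
Qed.

Lemma raw_comp_E a b c (e : hom E a b) (s : coprod E M b c) :
  is_prod_mor r s -> raw_comp r s (rep r (idm M b) e) = act (idm M c) e s.
Proof.
intros [x [f [n ->]]]; rewrite raw_comp_rep, act_rep.
change (act n e (rho r f (idm M b)) = rep r (idm M c ∘ n) (f ∘ e)).
now rewrite rho_1r, act_act, comp_idr, comp_idl.
Qed.

Definition E_functor : io_functor E (product_category r).
Proof.
refine (@IOFunctor O E (product_category r)
  (fun a b e => exist _ (rep r (idm M b) e) (is_prod_mor_rep r (idm M b) e)) _ _).
- intros a; apply prod_hom_inj; cbn; now rewrite rho_id.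
- intros a b c g f; apply prod_hom_inj; cbn.
  rewrite raw_comp_E by apply is_prod_mor_rep.
  now rewrite act_rep, comp_idl.
Defined.

Definition M_functor : io_functor M (product_category r).
Proof.
refine (@IOFunctor O M (product_category r)
  (fun a b m => exist _ (rep r m (idm E a)) (is_prod_mor_rep r m (idm E a))) _ _).
- intros a; apply prod_hom_inj; cbn; now rewrite rho_id.
- intros a b c g f; apply prod_hom_inj; cbn.
  rewrite raw_comp_M by apply is_prod_mor_rep.
  now rewrite act_rep, comp_idl.
Defined.

Lemma M_functor_comp a b c (m : hom M b c) (s : hom (product_category r) a b) :
  proj1_sig (fmap M_functor m ∘ s) = act m (idm E a) (proj1_sig s).
Proof. apply raw_comp_M, (proj2_sig s). Qed.

Lemma E_functor_comp a b c (e : hom E a b) (s : hom (product_category r) b c) :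
  proj1_sig (s ∘ fmap E_functor e) = act (idm M c) e (proj1_sig s).
Proof. apply raw_comp_E, (proj2_sig s). Qed.

Lemma product_factor a c (f : hom (product_category r) a c) :
  exists b (e : hom E a b) (m : hom M b c),
    f = fmap M_functor m ∘ fmap E_functor e.
Proof.
destruct f as [s [b [e [m ->]]]]; exists b, e, m.
apply prod_hom_inj; rewrite M_functor_comp; cbn.
now rewrite act_rep, comp_idr, comp_idr.
Qed.

(** A diagonal of the square has to consist of the [M]-part of the top [u] and
    the [E]-part of the bottom [v]. *)
Lemma E_orth_M x a y b (e : hom E x a) (m : hom M y b) :
  orth (fmap E_functor e) (fmap M_functor m).
Proof.
intros [[z [um ue]] hu] [[z' [vm ve]] hv] sq.
apply (f_equal (@proj1_sig _ _)) in sq.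
rewrite M_functor_comp, E_functor_comp in sq; unfold act in sq; cbn in sq.
assert (zz : z = z') by exact (f_equal (@mid _ _ _ _ _) sq).
destruct zz.
apply span_inj in sq as [mum vee].
rewrite comp_idl in mum; rewrite comp_idr in vee.
exists (exist _ (span um ve) (is_prod_mor_mix hu hv) : hom (product_category r) a y).
split; [split|].
- apply prod_hom_inj; rewrite E_functor_comp; unfold act; cbn.
  now rewrite comp_idl, <- vee.
- apply prod_hom_inj; rewrite M_functor_comp; unfold act; cbn.
  now rewrite comp_idr, mum.
- intros [[w [n f]] ht] [te mt]; apply prod_hom_inj; cbn.
  apply (f_equal (@proj1_sig _ _)) in te, mt.
  rewrite E_functor_comp in te; rewrite M_functor_comp in mt.
  unfold act in te, mt; cbn in te, mt.
  assert (wz : w = z) by exact (f_equal (@mid _ _ _ _ _) te).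
  destruct wz.
  apply span_inj in te as [<- _], mt as [_ <-].
  now rewrite comp_idl, comp_idr.
Qed.

End ProductCategory.

Theorem corollary3p10 (O : Type) (E M : category O)
  (r : weak_distributive_law E M) :
  exists F : orthogonal_factorization_system (product_category r),
    inhabited (io_functor E (left_class F)) /\
    inhabited (io_functor M (right_class F)).
Proof.
exact (factorization_system_generated (@product_factor _ _ _ r)
         (@E_orth_M _ _ _ r)).
Qed.
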